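(* Let $\alpha,\beta$ be real and $n\ge0$ an integer such that the HR polynomials below are well-defined. Let $$L_1=z(1-z)\partial_z^2+(1-\beta-(2+\alpha)z)\partial_z,\qquad L_2=(1-z)\partial_z-(\alpha+1)I.$$ The generalized eigenvalue problem $L_1\phi=\theta L_2\phi$ has two classes of quasi-polynomial eigenfunctions: for $j=1,2$, $$(L_1-\theta^{(j)}_nL_2)\phi^{(j,n)}(z)=0,\qquad \phi^{(j,n)}(z)=\xi_j(z)p^{(j)}_n(z),$$ where $$\xi_1(z)=1,\quad p^{(1)}_n(z)=P_n(z;\alpha,\beta),\quad\theta^{(1)}_n=n;$$ $$\xi_2(z)=(1-z)^{-\alpha-\beta},\quad p^{(2)}_n(z)=P_n(z;-\beta,-\alpha),\quad \theta^{(2)}_n=n-\alpha-\beta.$$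
   Context: HR polynomials: $P_n(z;a,b)=\frac{(b)_n}{(a+1)_n}\,{}_2F_1(-n,a+1;1-b-n;z)$, $(a)_n$ the Pochhammer symbol; well-defined when $(a+1)_n\ne0$ and $b\notin\{0,-1,\ldots,1-n\}$. $\partial_z=d/dz$. A quasi-polynomial eigenfunction is an eigenfunction that is a product of a gauge function $\xi(z)$ and a polynomial $p(z)$. Powers are taken with any fixed holomorphic branch on a domain avoiding the branch points. *)

(* Defs.v *)
From Stdlib Require Export Reals Factorial.
From Coquelicot Require Export Coquelicot.

Open Scope C_scope.

Fixpoint pochhammer (a : R) (n : nat) : R :=
  match n with
  | O => 1%R
  | S m => (pochhammer a m * (a + INR m))%R
  end.

(** The terminating series 2F1(-n, b; c; z): the factor (-n)_k vanishes for
    k > n, so the sum stops at k = n.  It is meaningful when (c)_k <> 0 for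
    all k <= n. *)
Definition hyp2F1_neg (n : nat) (b c : R) (z : C) : C :=
  sum_n (fun k =>
    RtoC (pochhammer (- INR n) k * pochhammer b k
          / (pochhammer c k * INR (fact k))) * z ^ k) n.

Definition hr_poly (n : nat) (a b : R) (z : C) : C :=
  RtoC (pochhammer b n / pochhammer (a + 1) n)
  * hyp2F1_neg n (a + 1) (1 - b - INR n) z.

Definition hr_well_defined (n : nat) (a b : R) : Prop :=
  pochhammer (a + 1) n <> 0%R /\ (forall k : nat, (k < n)%nat -> b <> (- INR k)%R).

Definition L1 (alpha beta : R) (f : C -> C) (z : C) : C :=
  z * (1 - z) * C_derive (C_derive f) z
  + (1 - beta - (2 + alpha) * z) * C_derive f z.

Definition L2 (alpha : R) (f : C -> C) (z : C) : C :=
  (1 - z) * C_derive f z - (alpha + 1) * f z.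

Definition holomorphic_on (D : C -> Prop) (f : C -> C) : Prop :=
  forall z : C, D z -> ex_derive (K := C_AbsRing) (V := C_NormedModule) f z.

Definition connected_set (D : C -> Prop) : Prop :=
  forall U V : C -> Prop, open U -> open V ->
    (forall z, D z -> U z \/ V z) ->
    (exists z, D z /\ U z) -> (exists z, D z /\ V z) ->
    exists z, D z /\ U z /\ V z.

Definition domain (D : C -> Prop) : Prop :=
  open D /\ connected_set D /\ (exists z, D z).

Definition Cexp (z : C) : C :=
  ((exp (Re z) * cos (Im z))%R, (exp (Re z) * sin (Im z))%R).

(** [xi] is a holomorphic branch on [D] of the multivalued power [g ^ s]: at
    each point its value is [exp (s * l)] for some logarithm [l] of [g z]. *)
Definition power_branch (D : C -> Prop) (g : C -> C) (s : C) (xi : C -> C) : Prop :=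
  holomorphic_on D xi /\
  (forall z, D z -> exists l : C, Cexp l = g z /\ xi z = Cexp (s * l)).

(** [C_derive] is a total operator, so the differentiability needed for
    second-order operators is required explicitly. *)
Definition generalized_eigenfunction (D : C -> Prop)
    (A B : (C -> C) -> C -> C) (theta : C) (phi : C -> C) : Prop :=
  holomorphic_on D phi /\ holomorphic_on D (C_derive phi) /\
  (exists z, D z /\ phi z <> 0) /\
  (forall z, D z -> A phi z - theta * B phi z = 0).

Definition is_polynomial (p : C -> C) : Prop :=
  exists (m : nat) (c : nat -> C), forall z, p z = sum_n (fun k => c k * z ^ k) m.

Definition quasi_polynomial_eigenfunction (D : C -> Prop)
    (A B : (C -> C) -> C -> C) (theta : C) (xi p : C -> C) : Prop :=
  is_polynomial p /\
  generalized_eigenfunction D A B theta (fun z => xi z * p z).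

(* Main.v *)
From Stdlib Require Import Lra Lia.
Require Import Defs.

(** Substituting [theta = n] in the first case turns [L1 - theta L2] into the
    hypergeometric operator whose terminating solution is [P_n].  The second
    case is Euler's transformation: conjugating [L1 - theta L2] by
    [(1 - z) ^ (- alpha - beta)] gives again a hypergeometric operator.  The
    only fact about the branch [xi] of [(1 - z) ^ s] which is needed is
    [(1 - z) xi' = - s xi].  Since [s] is real, [xi] is holomorphic with
    [|xi| ^ 2 = exp (s ln |1 - z| ^ 2)], and the two real partial derivatives of
    this identity determine [xi']; no local logarithm has to be constructed. *)

(** * Rules of complex differentiation *)

Definition is_C_derive (f : C -> C) (z l : C) : Prop :=
  is_derive (K := C_AbsRing) (V := C_NormedModule) f z l.

(** Coquelicot's product rule is stated for this second, not convertible,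
    normed module structure on [C]. *)
Lemma is_C_derive_AbsRing (f : C -> C) (z l : C) :
  is_C_derive f z l <->
  is_derive (K := C_AbsRing) (V := AbsRing_NormedModule C_AbsRing) f z l.
Proof.
  split; intros [[Hp Hs Hn] Hd]; split; try exact Hd; split; assumption.
Qed.

Lemma is_C_derive_mult (f g : C -> C) (z df dg : C) :
  is_C_derive f z df -> is_C_derive g z dg ->
  is_C_derive (fun x => f x * g x) z (df * g z + f z * dg).
Proof.
  intros Hf Hg; apply is_C_derive_AbsRing.
  apply (is_derive_mult (K := C_AbsRing) f g z df dg).
  - now apply is_C_derive_AbsRing.
  - now apply is_C_derive_AbsRing.
  - exact Cmult_comm.
Qed.

Lemma is_C_derive_comp (f g : C -> C) (z df dg : C) :
  is_C_derive f (g z) df -> is_C_derive g z dg ->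
  is_C_derive (fun x => f (g x)) z (dg * df).
Proof.
  intros Hf Hg.
  apply (is_derive_comp (K := C_AbsRing) (V := C_NormedModule) f g); [exact Hf|].
  now apply is_C_derive_AbsRing.
Qed.

Lemma is_C_derive_plus (f g : C -> C) (z df dg : C) :
  is_C_derive f z df -> is_C_derive g z dg ->
  is_C_derive (fun x => f x + g x) z (df + dg).
Proof. exact (is_derive_plus (K := C_AbsRing) (V := C_NormedModule) f g z df dg). Qed.

Lemma is_C_derive_const (c z : C) : is_C_derive (fun _ => c) z 0.
Proof. exact (is_derive_const (K := C_AbsRing) (V := C_NormedModule) c z). Qed.

Lemma is_C_derive_id (z : C) : is_C_derive (fun x => x) z 1.
Proof. apply is_C_derive_AbsRing, (is_derive_id (K := C_AbsRing)). Qed.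

Lemma is_C_derive_eq (f : C -> C) (z l l' : C) :
  is_C_derive f z l -> l = l' -> is_C_derive f z l'.
Proof. now intros H <-. Qed.

Lemma is_C_derive_one_sub (z : C) : is_C_derive (fun x => 1 - x) z (- (1)).
Proof.
  apply is_C_derive_eq with (0 - 1); [|ring].
  apply (is_derive_minus (K := C_AbsRing) (V := C_NormedModule) (fun _ => RtoC 1) (fun x => x)).
  - apply is_C_derive_const.
  - apply is_C_derive_id.
Qed.

(** At [k = 0] the truncated exponent [pred k] is harmless, since the factor [INR k] vanishes. *)
Lemma is_C_derive_pow (k : nat) (z : C) :
  is_C_derive (fun x => x ^ k) z (INR k * z ^ pred k).
Proof.
  induction k as [|k IH].
  - apply is_C_derive_eq with (1 := is_C_derive_const 1 z). simpl; ring.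
  - apply is_C_derive_eq with (1 := is_C_derive_mult _ _ z _ _ (is_C_derive_id z) IH).
    rewrite S_INR, RtoC_plus. destruct k; [simpl; ring|].
    generalize (INR (S k)); intros x; simpl; ring.
Qed.

Lemma is_C_derive_poly (c : nat -> C) (m : nat) (z : C) :
  is_C_derive (fun x => sum_n (fun k => c k * x ^ k) m) z
    (sum_n (fun k => c k * (INR k * z ^ pred k)) m).
Proof.
  apply (is_derive_sum_n (K := C_AbsRing) (V := C_NormedModule)
           (fun k x => c k * x ^ k)).
  intros k _.
  eapply is_C_derive_eq.
  - exact (is_C_derive_mult _ _ z _ _ (is_C_derive_const (c k) z) (is_C_derive_pow k z)).
  - cbv beta; ring.
Qed.

Lemma is_C_derive_of_bound (f : C -> C) (z l : C) :
  (forall eps, (0 < eps)%R -> exists delta, (0 < delta)%R /\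
    forall w, (Cmod w < delta)%R ->
      (Cmod (f (z + w) - f z - w * l)%C <= eps * Cmod w)%R) ->
  is_C_derive f z l.
Proof.
  intros H; split.
  - apply (is_linear_scal_l (K := C_AbsRing) (V := C_NormedModule)).
  - intros x Hx eps.
    (* The neighbourhood filter of [z] has no limit point [x] other than [z]. *)
    rewrite <- (is_filter_lim_locally_unique _ _ Hx).
    destruct (H eps (cond_pos eps)) as [delta [Hd Hb]].
    exists (mkposreal delta Hd); intros y Hy.
    change (Cmod (y - z)%C < delta)%R in Hy.
    change (Cmod (f y - f z - (y - z) * l)%C <= eps * Cmod (y - z)%C)%R.
    replace (f y) with (f (z + (y - z))) by (f_equal; ring).
    exact (Hb _ Hy).
Qed.

(** The remainder of the linear approximation at increment [w] has the closed form
    [w ^ 2 / (a ^ 2 * (a + w))], which is quadratic in [w] as long as [a + w] stays away from 0. *)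
Lemma is_C_derive_inv (a : C) :
  a <> 0 -> is_C_derive Cinv a (- / (a * a)).
Proof.
  intros Ha; apply is_C_derive_of_bound; intros eps Heps.
  assert (Hm := proj1 (Cmod_gt_0 a) Ha).
  set (m := Cmod a) in *.
  assert (Hm3 : (0 < eps * m ^ 3 / 2)%R)
    by (apply Rdiv_lt_0_compat; [apply Rmult_lt_0_compat; [lra|now apply pow_lt] | lra]).
  (* The first radius keeps [|a + w| > m / 2], so the remainder is at most [2 |w| ^ 2 / m ^ 3]; the
     second makes this at most [eps * |w|]. *)
  exists (Rmin (m / 2) (eps * m ^ 3 / 2)); split; [apply Rmin_pos; lra|].
  intros w Hw.
  assert (Hw1 := Rlt_le_trans _ _ _ Hw (Rmin_l _ _)).
  assert (Hw2 := Rlt_le_trans _ _ _ Hw (Rmin_r _ _)).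
  assert (Haw : (m / 2 < Cmod (a + w)%C)%R).
  { assert (T := Cmod_triangle (a + w) (- w)).
    rewrite Cmod_opp in T; replace (a + w + - w) with a in T by ring.
    fold m in T; lra. }
  assert (Hn : a + w <> 0) by (apply Cmod_gt_0; lra).
  replace (/ (a + w) - / a - w * - / (a * a)) with (w * w / (a * a * (a + w)))
    by (field; auto).
  rewrite Cmod_div, !Cmod_mult by (repeat apply Cmult_neq_0; auto).
  fold m.
  assert (Hw0 := Cmod_ge_0 w).
  set (u := Cmod w) in *; set (v := Cmod (a + w)%C) in *.
  assert (Hmv : (m ^ 3 / 2 <= m * m * v)%R) by nra.
  assert (Hmp := pow_lt m 3 Hm).
  apply Rmult_le_reg_r with (m * m * v)%R; [lra|].
  replace (u * u / (m * m * v) * (m * m * v))%R with (u * u)%R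
    by (field; split; lra).
  assert (u <= eps * (m * m * v))%R
    by (apply Rlt_le, Rlt_le_trans with (1 := Hw2); nra).
  nra.
Qed.

(** * Polynomials as finite sums *)

Lemma sum_n_C_S (f : nat -> C) (m : nat) : sum_n f (S m) = sum_n f m + f (S m).
Proof. exact (sum_Sn f m). Qed.

Lemma sum_n_C_shift (f : nat -> C) (m : nat) :
  sum_n f (S m) = f O + sum_n (fun k => f (S k)) m.
Proof.
  induction m as [|m IH].
  - now rewrite sum_n_C_S, !sum_O.
  - rewrite sum_n_C_S, IH, sum_n_C_S, Cplus_assoc; reflexivity.
Qed.

Lemma is_C_derive_poly2 (c : nat -> C) (m : nat) (z : C) :
  is_C_derive (fun x => sum_n (fun k => c k * (INR k * x ^ pred k)) m) z
    (sum_n (fun k => c k * (INR k * (INR (pred k) * z ^ pred (pred k)))) m).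
Proof.
  apply (is_derive_sum_n (K := C_AbsRing) (V := C_NormedModule)
           (fun k x => c k * (INR k * x ^ pred k))).
  intros k _.
  eapply is_C_derive_eq.
  - refine (is_C_derive_mult _ _ z _ _ (is_C_derive_const (c k) z)
              (is_C_derive_mult _ _ z _ _ (is_C_derive_const (INR k) z)
                 (is_C_derive_pow (pred k) z))).
  - cbv beta; ring.
Qed.

Lemma open_locally (D : C -> Prop) (z : C) :
  open D -> D z -> locally (T := AbsRing_UniformSpace C_AbsRing) z D.
Proof. intros HD Hz; apply locally_C; exact (HD z Hz). Qed.

Lemma is_C_derive_ext_open (D : C -> Prop) (f g : C -> C) (z l : C) :
  open D -> D z -> (forall x, D x -> f x = g x) ->
  is_C_derive f z l -> is_C_derive g z l.
Proof.
  intros HD Hz Hfg.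
  apply (is_derive_ext_loc (K := C_AbsRing) (V := C_NormedModule)).
  generalize (open_locally D z HD Hz); apply filter_imp; exact Hfg.
Qed.

(** Induction on the degree bound by differentiation: on an open set the derivative vanishes as
    well, and its coefficients [(k + 1) c (k + 1)] are 0 by induction. Only the constant term is
    left, and any point of [D] shows that it is 0. *)
Lemma poly_zero_on_open (D : C -> Prop) (m : nat) (c : nat -> C) :
  open D -> (exists z, D z) ->
  (forall z, D z -> sum_n (fun k => c k * z ^ k) m = RtoC 0) ->
  forall k, (k <= m)%nat -> c k = 0.
Proof.
  intros HD [z0 Hz0]; revert c; induction m as [|m IH]; intros c H0.
  - intros k Hk; replace k with O by lia.
    generalize (H0 z0 Hz0); rewrite sum_O; simpl; intros <-; ring.
  - assert (HS : forall k, (k <= m)%nat -> c (S k) = 0).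
    { intros k Hk.
      assert (Hc : INR (S k) * c (S k) = 0).
      { apply (IH (fun k => INR (S k) * c (S k))); [|exact Hk].
        intros z Hz.
        assert (Hd := is_C_derive_ext_open D _ (fun _ => 0) z _ HD Hz H0
                        (is_C_derive_poly c (S m) z)).
        apply is_C_derive_unique in Hd.
        rewrite (is_C_derive_unique _ _ _ (is_C_derive_const 0 z)) in Hd.
        rewrite sum_n_C_shift in Hd; rewrite Hd.
        replace (c 0%nat * (INR 0 * z ^ pred 0)) with (RtoC 0) by (simpl; ring).
        rewrite Cplus_0_l; apply sum_n_ext; intros j.
        rewrite Nat.pred_succ, (Cmult_comm (INR (S j)) (c (S j))).
        symmetry; apply Cmult_assoc. }
      destruct (Ceq_dec (c (S k)) 0) as [E|E]; [exact E|exfalso].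
      apply (Cmult_neq_0 (INR (S k)) (c (S k))); auto.
      intros E'; apply RtoC_inj in E'; revert E'; apply not_0_INR; lia. }
    intros [|k] Hk; [|apply HS; lia].
    generalize (H0 z0 Hz0); rewrite sum_n_C_shift.
    rewrite (sum_n_ext_loc _ (fun _ => @zero C_AbelianMonoid)).
    + unfold sum_n; rewrite sum_n_m_const_zero.
      change (@zero C_AbelianMonoid) with (RtoC 0).
      intros <-; simpl; ring.
    + intros j Hj; rewrite HS by lia.
      change (@zero C_AbelianMonoid) with (RtoC 0); apply Cmult_0_l.
Qed.

(** * The hypergeometric equation and the HR polynomials *)

(** Applied to [z ^ k] the operator gives
    [k (k - 1 + c) z ^ (k - 1) - (k + A) (k + B) z ^ k], so the sum telescopes. *)
Lemma hypergeometric_partial_sum (A B c : R) (d : nat -> R) (m : nat) (z : C) :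
  (forall k, (k < m)%nat ->
     ((INR k + 1) * (INR k + c) * d (S k) = (INR k + A) * (INR k + B) * d k)%R) ->
  z * (1 - z) *
    sum_n (fun k => d k * (INR k * (INR (pred k) * z ^ pred (pred k)))) m
  + (c - (A + B + 1) * z) * sum_n (fun k => d k * (INR k * z ^ pred k)) m
  - A * B * sum_n (fun k => d k * z ^ k) m
  = - ((INR m + A) * (INR m + B) * d m * z ^ m).
Proof.
  induction m as [|m IH]; intros Hrec.
  - rewrite !sum_O; simpl; ring.
  - rewrite !sum_n_C_S.
    assert (Hm : (INR m + 1) * (INR m + c) * d (S m)
                 = (INR m + A) * (INR m + B) * d m).
    { rewrite <- !RtoC_plus, <- !RtoC_mult; f_equal; apply Hrec; lia. }
    assert (IH' := IH (fun k Hk => Hrec k (Nat.lt_lt_succ_r _ _ Hk))).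
    (* In this form the remainder left at degree [m] cancels the [z ^ m] term contributed by the
       coefficient [d (S m)]. *)
    rewrite <- Hm in IH'.
    set (S2 := sum_n (fun k => d k * (INR k * (INR (pred k) * z ^ pred (pred k)))) m) in *.
    set (S1 := sum_n (fun k => d k * (INR k * z ^ pred k)) m) in *.
    set (S0 := sum_n (fun k => d k * z ^ k) m) in *.
    transitivity
      ((z * (1 - z) * S2 + (c - (A + B + 1) * z) * S1 - A * B * S0)
       + d (S m) * (z * (1 - z) * (INR (S m) * (INR m * z ^ pred m))
          + (c - (A + B + 1) * z) * (INR (S m) * z ^ m)
          - A * B * z ^ S m)); [rewrite Nat.pred_succ; ring|].
    rewrite IH', S_INR, RtoC_plus.
    (* [z * z ^ pred m] equals [z ^ m] only for positive [m]; at [m = 0] the term dies by its factor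
       [INR m]. *)
    destruct m as [|m]; [simpl; ring|].
    rewrite S_INR, RtoC_plus; simpl; ring.
Qed.

Lemma pochhammer_neq_0 (a : R) (k : nat) :
  (forall i, (i < k)%nat -> (a + INR i)%R <> 0%R) -> pochhammer a k <> 0%R.
Proof.
  induction k as [|k IH]; intros H; simpl; [lra|].
  apply Rmult_integral_contrapositive_currified; [apply IH|apply H]; auto with arith.
Qed.

Definition hr_coeff (n : nat) (a b : R) (k : nat) : R :=
  (pochhammer b n / pochhammer (a + 1) n *
   (pochhammer (- INR n) k * pochhammer (a + 1) k
    / (pochhammer (1 - b - INR n) k * INR (fact k))))%R.

Lemma hr_poly_coeff (n : nat) (a b : R) (z : C) :
  hr_poly n a b z = sum_n (fun k => hr_coeff n a b k * z ^ k) n.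
Proof.
  unfold hr_poly, hyp2F1_neg.
  rewrite <- (sum_n_mult_l (K := C_Ring)); apply sum_n_ext; intros k.
  unfold hr_coeff; rewrite RtoC_mult.
  apply Cmult_assoc.
Qed.

(** The factor vanishes exactly when [b = - (n - 1 - i)], and [n - 1 - i] is again one of the
    indices below [n] at which [b] is restricted. *)
Lemma hr_denominator_neq_0 (n : nat) (a b : R) (i : nat) :
  hr_well_defined n a b -> (i < n)%nat -> (1 - b - INR n + INR i)%R <> 0%R.
Proof.
  intros [_ Hb] Hi E; apply (Hb (n - 1 - i)%nat); [lia|].
  rewrite !minus_INR by lia; simpl; lra.
Qed.

Lemma hr_coeff_rec (n : nat) (a b : R) (k : nat) :
  hr_well_defined n a b -> (k < n)%nat ->
  ((INR k + 1) * (INR k + (1 - b - INR n)) * hr_coeff n a b (S k)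
   = (INR k + - INR n) * (INR k + (a + 1)) * hr_coeff n a b k)%R.
Proof.
  intros H Hk; unfold hr_coeff.
  change (pochhammer ?x (S k)) with (pochhammer x k * (x + INR k))%R.
  rewrite fact_simpl, mult_INR, S_INR.
  assert (H1 := hr_denominator_neq_0 n a b k H Hk).
  assert (H2 : pochhammer (1 - b - INR n) k <> 0%R).
  { apply pochhammer_neq_0; intros i Hi; apply (hr_denominator_neq_0 n a b i H); lia. }
  assert (H3 := INR_fact_neq_0 k).
  assert (H4 := pos_INR k).
  destruct H as [H5 _].
  field; repeat split; auto; lra.
Qed.

(** The constant coefficient is [(b)_n / (a + 1)_n], whose numerator has no zero factor. This is
    what keeps the polynomial from being identically zero on a domain. *)
Lemma hr_coeff_0 (n : nat) (a b : R) :
  hr_well_defined n a b -> hr_coeff n a b 0 <> 0%R.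
Proof.
  intros [Ha Hb]; unfold hr_coeff; simpl.
  assert (Hn : pochhammer b n <> 0%R).
  { apply pochhammer_neq_0; intros i Hi E; apply (Hb i Hi); lra. }
  intros E; apply Hn.
  replace (pochhammer b n) with
    (pochhammer b n / pochhammer (a + 1) n * (1 * 1 / (1 * 1)) * pochhammer (a + 1) n)%R
    by (field; exact Ha).
  rewrite E; ring.
Qed.

Lemma hr_poly_is_polynomial (n : nat) (a b : R) : is_polynomial (hr_poly n a b).
Proof. exists n, (fun k => RtoC (hr_coeff n a b k)); apply hr_poly_coeff. Qed.

Lemma hr_poly_nonzero (n : nat) (a b : R) (D : C -> Prop) :
  hr_well_defined n a b -> open D -> (exists z, D z) ->
  exists z, D z /\ hr_poly n a b z <> 0.
Proof.
  intros Hw HD Hne.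
  apply Classical_Prop.NNPP; intros Hno.
  apply (hr_coeff_0 n a b Hw), RtoC_inj.
  apply (poly_zero_on_open D n (fun k => RtoC (hr_coeff n a b k)) HD Hne); [|lia].
  intros z Hz; rewrite <- hr_poly_coeff.
  apply Classical_Prop.NNPP; intros Hz0; apply Hno; now exists z.
Qed.

(** This is the hypergeometric equation with parameters [A = - n], [B = a + 1], [c = 1 - b - n]. The
    derivatives are supplied as functions so that they can enter product rules directly. *)
Lemma hr_poly_ode (n : nat) (a b : R) :
  hr_well_defined n a b ->
  exists p1 p2 : C -> C,
    (forall z, is_C_derive (hr_poly n a b) z (p1 z)) /\
    (forall z, is_C_derive p1 z (p2 z)) /\
    (forall z, z * (1 - z) * p2 z
       + (1 - b - INR n - (- INR n + a + 2) * z) * p1 z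
       + INR n * (a + 1) * hr_poly n a b z = 0).
Proof.
  intros Hw.
  set (d := hr_coeff n a b).
  exists (fun z => sum_n (fun k => d k * (INR k * z ^ pred k)) n),
    (fun z => sum_n (fun k => d k * (INR k * (INR (pred k) * z ^ pred (pred k)))) n).
  split; [|split]; intros z.
  - apply (is_derive_ext (K := C_AbsRing) (V := C_NormedModule)
             (fun x => sum_n (fun k => d k * x ^ k) n)).
    + intros x; symmetry; apply hr_poly_coeff.
    + apply (is_C_derive_poly (fun k => RtoC (d k))).
  - apply (is_C_derive_poly2 (fun k => RtoC (d k))).
  - rewrite hr_poly_coeff; fold d.
    assert (H := hypergeometric_partial_sum (- INR n) (a + 1) (1 - b - INR n) d n z
                   (fun k => hr_coeff_rec n a b k Hw)).
    rewrite !RtoC_minus, !RtoC_plus, !RtoC_opp in H.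
    (* The remainder of the partial sum carries the factor [n + A = 0]: the series terminates at
       [n]. *)
    replace (- ((INR n + - INR n) * _ * _ * _)) with (RtoC 0) in H by ring.
    rewrite <- H; ring.
Qed.

(** * Real directional derivatives of complex functions *)

Lemma is_C_derive_bound (f : C -> C) (z l : C) :
  is_C_derive f z l ->
  forall eps, (0 < eps)%R -> exists delta, (0 < delta)%R /\
    forall w, (Cmod w < delta)%R ->
      (Cmod (f (z + w) - f z - w * l)%C <= eps * Cmod w)%R.
Proof.
  intros [_ Hd] eps Heps.
  destruct (Hd z (fun P HP => HP) (mkposreal eps Heps)) as [delta Hdelta].
  exists delta; split; [apply cond_pos|]; intros w Hw.
  assert (E : w = (z + w) - z) by ring.
  rewrite E in Hw.
  generalize (Hdelta (z + w) Hw).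
  change (Cmod (f (z + w) - f z - (z + w - z) * l)%C <= eps * Cmod (z + w - z)%C ->
          Cmod (f (z + w) - f z - w * l)%C <= eps * Cmod w)%R.
  now rewrite <- E.
Qed.

(** [P] stands for [Re] or [Im]: being real-linear and bounded by the modulus, it carries the
    complex error estimate over to the real difference quotient. *)
Lemma is_C_derive_directional (f : C -> C) (z l h : C) (P : C -> R) :
  (forall x y, P (x - y)%C = P x - P y)%R ->
  (forall (t : R) x, P (t * x)%C = (t * P x)%R) ->
  (forall x, Rabs (P x) <= Cmod x)%R ->
  is_C_derive f z l ->
  is_derive (fun t : R => P (f (z + t * h))) 0%R (P (l * h)).
Proof.
  intros Psub Pscal Ple Hf; apply is_derive_Reals; intros eps Heps.
  assert (Hh := Cmod_ge_0 h).
  (* Dividing by [Cmod h + 1] instead of [Cmod h] covers [h = 0] and makes the final inequality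
     strict. *)
  assert (He : (0 < eps / (Cmod h + 1))%R) by (apply Rdiv_lt_0_compat; lra).
  destruct (is_C_derive_bound f z l Hf _ He) as [delta [Hdelta H]].
  assert (Hd : (0 < delta / (Cmod h + 1))%R) by (apply Rdiv_lt_0_compat; lra).
  exists (mkposreal _ Hd); simpl; intros t Ht0 Ht.
  assert (Hat := Rabs_pos_lt t Ht0).
  assert (Hth : Cmod (t * h)%C = (Rabs t * Cmod h)%R)
    by (rewrite Cmod_mult, Cmod_R; reflexivity).
  assert (Htd : (Cmod (t * h)%C < delta)%R).
  { rewrite Hth.
    apply Rle_lt_trans with (Rabs t * (Cmod h + 1))%R; [nra|].
    apply (Rmult_lt_compat_r (Cmod h + 1)) in Ht; [|lra].
    replace (delta / (Cmod h + 1) * (Cmod h + 1))%R with delta in Ht by (field; lra).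
    exact Ht. }
  specialize (H _ Htd).
  rewrite Rplus_0_l; replace (z + 0%R * h) with z by ring.
  replace ((P (f (z + t * h)%C) - P (f z)) / t - P (l * h)%C)%R
    with (P (f (z + t * h) - f z - t * h * l)%C / t)%R.
  2: { rewrite !Psub; replace (t * h * l) with (t * (l * h)) by ring.
       rewrite Pscal; field; exact Ht0. }
  unfold Rdiv; rewrite Rabs_mult, Rabs_inv.
  apply Rmult_lt_reg_r with (Rabs t); [exact Hat|].
  rewrite Rmult_assoc, Rinv_l, Rmult_1_r by lra.
  apply Rle_lt_trans with (1 := Ple _), Rle_lt_trans with (1 := H).
  rewrite Hth.
  replace (eps / (Cmod h + 1) * (Rabs t * Cmod h))%R
    with (eps * Rabs t * (Cmod h / (Cmod h + 1)))%R by (field; lra).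
  assert (Hq : (Cmod h / (Cmod h + 1) < 1)%R).
  { apply Rmult_lt_reg_r with (Cmod h + 1)%R; [lra|].
    replace (Cmod h / (Cmod h + 1) * (Cmod h + 1))%R with (Cmod h) by (field; lra).
    lra. }
  assert (0 < eps * Rabs t)%R by (apply Rmult_lt_0_compat; lra).
  nra.
Qed.

Lemma is_C_derive_directional_Re (f : C -> C) (z l h : C) :
  is_C_derive f z l ->
  is_derive (fun t : R => Re (f (z + t * h))) 0%R (Re (l * h)).
Proof.
  apply is_C_derive_directional.
  - reflexivity.
  - intros t x; unfold Re, Im; simpl; ring.
  - exact re_le_Cmod.
Qed.

Lemma is_C_derive_directional_Im (f : C -> C) (z l h : C) :
  is_C_derive f z l ->
  is_derive (fun t : R => Im (f (z + t * h))) 0%R (Im (l * h)).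
Proof.
  apply is_C_derive_directional.
  - reflexivity.
  - intros t x; unfold Re, Im; simpl; ring.
  - intros x; apply Rle_trans with (2 := Rmax_Cmod x), Rmax_r.
Qed.

(** Lets an identity known only on [D] be differentiated at [t = 0] along a real line through
    [z]. *)
Lemma open_line (D : C -> Prop) (z h : C) :
  open D -> D z -> locally 0%R (fun t : R => D (z + t * h)).
Proof.
  intros HD Hz.
  destruct (open_locally D z HD Hz) as [delta Hdelta].
  assert (Hh := Cmod_ge_0 h).
  assert (Hd : (0 < delta / (Cmod h + 1))%R)
    by (apply Rdiv_lt_0_compat; [apply cond_pos | lra]).
  exists (mkposreal _ Hd); intros t Ht; apply Hdelta.
  change (Cmod (z + t * h - z)%C < delta)%R.
  replace (z + t * h - z) with (t * h) by ring.
  change (Rabs (t - 0) < delta / (Cmod h + 1))%R in Ht.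
  rewrite Rminus_0_r in Ht.
  rewrite Cmod_mult, Cmod_R.
  apply (Rmult_lt_compat_r (Cmod h + 1)) in Ht; [|lra].
  replace (delta / (Cmod h + 1) * (Cmod h + 1))%R with (pos delta) in Ht by (field; lra).
  assert (H := Rabs_pos t); nra.
Qed.

(** * The derivative of a branch of a real power of [1 - z] *)

Lemma modulus_sqr_pos (w : C) : w <> 0 -> (0 < Re w ^ 2 + Im w ^ 2)%R.
Proof.
  intros Hw; destruct w as [x y]; simpl.
  destruct (Req_dec x 0) as [->|]; [|nra].
  destruct (Req_dec y 0) as [->|]; [now contradict Hw | nra].
Qed.

Lemma one_sub_neq_0 (z : C) : z <> 1 -> 1 - z <> 0.
Proof.
  intros Hz E; apply Hz; replace z with (1 - (1 - z)) by ring; rewrite E; ring.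
Qed.

(** Both sides of the modulus identity are differentiated along [t -> z + t h] at [t = 0]; the two
    results are equated, halved and cleared of the denominator [|1 - z| ^ 2]. *)
Lemma modulus_derivative_along (D : C -> Prop) (xi : C -> C) (s : R) (z l h : C) :
  open D -> D z -> z <> 1 ->
  (forall w, D w ->
     Re (xi w) ^ 2 + Im (xi w) ^ 2
     = exp (s * ln (Re (1 - w)%C ^ 2 + Im (1 - w)%C ^ 2)))%R ->
  is_C_derive xi z l ->
  ((Re (xi z) * Re (l * h)%C + Im (xi z) * Im (l * h)%C)
     * (Re (1 - z)%C ^ 2 + Im (1 - z)%C ^ 2)
   = - s * (Re (xi z) ^ 2 + Im (xi z) ^ 2)
     * (Re (1 - z)%C * Re h + Im (1 - z)%C * Im h))%R.
Proof.
  intros HD Hz Hz1 Hmod Hxi.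
  assert (HN : (0 < Re (1 - z)%C ^ 2 + Im (1 - z)%C ^ 2)%R)
    by exact (modulus_sqr_pos _ (one_sub_neq_0 z Hz1)).
  assert (H1 : is_derive
    (fun t : R => Re (xi (z + t * h))%C ^ 2 + Im (xi (z + t * h))%C ^ 2)%R 0%R
    (2 * (Re (xi z) * Re (l * h)%C + Im (xi z) * Im (l * h)%C))%R).
  { assert (HR := is_C_derive_directional_Re xi z l h Hxi).
    assert (HI := is_C_derive_directional_Im xi z l h Hxi).
    evar_last.
    - apply @is_derive_plus; apply is_derive_pow; eassumption.
    - cbv beta; replace (z + 0%R * h) with z by ring.
      change plus with Rplus; unfold Re, Im; simpl; ring. }
  assert (H2 : is_derive
    (fun t : R => Re (xi (z + t * h))%C ^ 2 + Im (xi (z + t * h))%C ^ 2)%R 0%R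
    (- 2 * s * exp (s * ln (Re (1 - z)%C ^ 2 + Im (1 - z)%C ^ 2))
       * (Re (1 - z)%C * Re h + Im (1 - z)%C * Im h)
       / (Re (1 - z)%C ^ 2 + Im (1 - z)%C ^ 2))%R).
  { apply is_derive_ext_loc with (fun t : R =>
      exp (s * ln ((Re (1 - z)%C - t * Re h) ^ 2 + (Im (1 - z)%C - t * Im h) ^ 2))%R).
    - generalize (open_line D z h HD Hz); apply filter_imp; intros t Ht.
      rewrite Hmod by exact Ht; unfold Re, Im; simpl.
      do 3 f_equal; ring.
    - set (u := Re (1 - z)%C) in *; set (v := Im (1 - z)%C) in *.
      (* The left side is the argument of the logarithm at [t = 0] in the shape that [auto_derive]
         produces. *)
      assert (EN : ((u + - (0 * Re h)) * ((u + - (0 * Re h)) * 1) +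
                    (v + - (0 * Im h)) * ((v + - (0 * Im h)) * 1)
                    = u ^ 2 + v ^ 2)%R) by ring.
      auto_derive; rewrite EN; [exact HN | field; lra]. }
  rewrite <- (Hmod z Hz) in H2.
  apply is_derive_unique in H1; apply is_derive_unique in H2.
  rewrite H1 in H2.
  apply Rmult_eq_reg_l with 2%R; [|lra].
  rewrite <- Rmult_assoc, H2; field; lra.
Qed.

(** The directions 1 and [i] together say [conj(xi) l |1 - z|^2 = - s |xi|^2 conj(1 - z)].
    Multiplying by [xi] and cancelling [|xi|^2], then multiplying by [1 - z] and cancelling
    [|1 - z|^2], gives the claim. *)
Lemma C_derive_of_modulus (D : C -> Prop) (xi : C -> C) (s : R) (z l : C) :
  open D -> D z -> z <> 1 ->
  (forall w, D w ->
     Re (xi w) ^ 2 + Im (xi w) ^ 2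
     = exp (s * ln (Re (1 - w)%C ^ 2 + Im (1 - w)%C ^ 2)))%R ->
  is_C_derive xi z l ->
  (1 - z) * l = - s * xi z.
Proof.
  intros HD Hz Hz1 Hmod Hxi.
  assert (H1 := modulus_derivative_along D xi s z l 1 HD Hz Hz1 Hmod Hxi).
  assert (H2 := modulus_derivative_along D xi s z l Ci HD Hz Hz1 Hmod Hxi).
  assert (HE : (0 < Re (xi z) ^ 2 + Im (xi z) ^ 2)%R)
    by (rewrite (Hmod z Hz); apply exp_pos).
  assert (HN : (0 < Re (1 - z)%C ^ 2 + Im (1 - z)%C ^ 2)%R)
    by exact (modulus_sqr_pos _ (one_sub_neq_0 z Hz1)).
  destruct (xi z) as [a b]; destruct l as [p q]; destruct (1 - z) as [x y].
  cbn [Re Im fst snd] in *.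
  assert (H1' : ((a * p + b * q) * (x ^ 2 + y ^ 2)
                 = - s * (a ^ 2 + b ^ 2) * x)%R)
    by (unfold Re, Im in H1; simpl in H1; lra).
  assert (H2' : ((b * p - a * q) * (x ^ 2 + y ^ 2)
                 = - s * (a ^ 2 + b ^ 2) * y)%R)
    by (unfold Re, Im in H2; simpl in H2; lra).
  (* [Hp] and [Hq] are the real and imaginary parts of [l |1 - z|^2 = - s xi conj(1 - z)]. *)
  assert (Hp : (p * (x ^ 2 + y ^ 2) = - s * (a * x + b * y))%R).
  { apply Rmult_eq_reg_l with (a ^ 2 + b ^ 2)%R; [|lra].
    transitivity (a * ((a * p + b * q) * (x ^ 2 + y ^ 2))
                  + b * ((b * p - a * q) * (x ^ 2 + y ^ 2)))%R; [ring|].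
    rewrite H1', H2'; ring. }
  assert (Hq : (q * (x ^ 2 + y ^ 2) = - s * (b * x - a * y))%R).
  { apply Rmult_eq_reg_l with (a ^ 2 + b ^ 2)%R; [|lra].
    transitivity (b * ((a * p + b * q) * (x ^ 2 + y ^ 2))
                  - a * ((b * p - a * q) * (x ^ 2 + y ^ 2)))%R; [ring|].
    rewrite H1', H2'; ring. }
  unfold Cmult; simpl; f_equal; apply Rmult_eq_reg_l with (x ^ 2 + y ^ 2)%R; try lra.
  - transitivity (x * (p * (x ^ 2 + y ^ 2)) - y * (q * (x ^ 2 + y ^ 2)))%R; [ring|].
    rewrite Hp, Hq; ring.
  - transitivity (x * (q * (x ^ 2 + y ^ 2)) + y * (p * (x ^ 2 + y ^ 2)))%R; [ring|].
    rewrite Hp, Hq; ring.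
Qed.

(** For real [s], [|exp (s l)|^2 = exp (2 s Re l)], and [2 Re l = ln |g z|^2] is the same for every
    logarithm [l] of [g z]. *)
Lemma power_branch_modulus (D : C -> Prop) (g xi : C -> C) (s : R) (z : C) :
  power_branch D g s xi -> D z ->
  (Re (xi z) ^ 2 + Im (xi z) ^ 2 = exp (s * ln (Re (g z) ^ 2 + Im (g z) ^ 2)))%R.
Proof.
  intros [_ Hl] Hz; destruct (Hl z Hz) as [l [<- ->]].
  assert (HC : forall w, (Re (Cexp w) ^ 2 + Im (Cexp w) ^ 2 = exp (2 * Re w))%R).
  { intros w; unfold Cexp; simpl.
    replace (2 * Re w)%R with (Re w + Re w)%R by ring.
    rewrite exp_plus.
    generalize (sin2_cos2 (Im w)); unfold Rsqr; intros E.
    transitivity (exp (Re w) * exp (Re w) *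
      (sin (Im w) * sin (Im w) + cos (Im w) * cos (Im w)))%R; [ring|].
    rewrite E; ring. }
  rewrite !HC, ln_exp; f_equal; unfold Re; simpl; ring.
Qed.

Lemma power_branch_derive (D : C -> Prop) (s : R) (xi : C -> C) (z : C) :
  open D -> ~ D 1 -> power_branch D (fun z => 1 - z) s xi -> D z ->
  is_C_derive xi z (- s * xi z / (1 - z)).
Proof.
  intros HD H1 Hb Hz.
  assert (Hz1 : z <> 1) by congruence.
  assert (Hd : is_C_derive xi z (C_derive xi z))
    by (apply C_derive_correct; [exact z | apply (proj1 Hb z Hz)]).
  apply is_C_derive_eq with (1 := Hd).
  rewrite <- (C_derive_of_modulus D xi s z (C_derive xi z) HD Hz Hz1); [| |exact Hd].
  - field; exact (one_sub_neq_0 z Hz1).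
  - intros w Hw; exact (power_branch_modulus D (fun z => 1 - z) xi s w Hb Hw).
Qed.

Lemma power_branch_neq_0 (D : C -> Prop) (g xi : C -> C) (s : R) (z : C) :
  power_branch D g s xi -> D z -> xi z <> 0.
Proof.
  intros Hb Hz E; generalize (power_branch_modulus D g xi s z Hb Hz).
  rewrite E; simpl; intros E'.
  match type of E' with _ = exp ?x => generalize (exp_pos x) end; lra.
Qed.

(** * Assembling the eigenfunctions *)

Lemma generalized_eigenfunction_intro (D : C -> Prop) (alpha beta : R) (theta : C)
    (phi phi1 phi2 : C -> C) :
  open D -> (exists z, D z /\ phi z <> 0) ->
  (forall z, D z -> is_C_derive phi z (phi1 z)) ->
  (forall z, D z -> is_C_derive phi1 z (phi2 z)) ->
  (forall z, D z ->
     z * (1 - z) * phi2 z + (1 - beta - (2 + alpha) * z) * phi1 z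
     - theta * ((1 - z) * phi1 z - (alpha + 1) * phi z) = 0) ->
  generalized_eigenfunction D (L1 alpha beta) (L2 alpha) theta phi.
Proof.
  intros HD Hne H1 H2 Heq.
  assert (E1 : forall z, D z -> C_derive phi z = phi1 z)
    by (intros z Hz; apply is_C_derive_unique, H1, Hz).
  (* [C_derive phi] is known to agree with [phi1] only on [D]; openness of [D] lets the agreement be
     differentiated. *)
  assert (H2' : forall z, D z -> is_C_derive (C_derive phi) z (phi2 z)).
  { intros z Hz; apply (is_C_derive_ext_open D phi1); auto.
    intros x Hx; symmetry; auto. }
  split; [|split; [|split]]; try exact Hne.
  - intros z Hz; exists (phi1 z); exact (H1 z Hz).
  - intros z Hz; exists (phi2 z); exact (H2' z Hz).
  - intros z Hz; unfold L1, L2.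
    rewrite (is_C_derive_unique _ _ _ (H2' z Hz)), E1 by exact Hz.
    exact (Heq z Hz).
Qed.

Theorem proposition3p2 :
  forall (alpha beta : R) (n : nat),
    hr_well_defined n alpha beta ->
    hr_well_defined n (- beta) (- alpha) ->
    (forall D : C -> Prop,
       domain D ->
       quasi_polynomial_eigenfunction D (L1 alpha beta) (L2 alpha)
         (INR n) (fun _ => 1) (hr_poly n alpha beta))
    /\
    (forall (D : C -> Prop) (xi2 : C -> C),
       domain D -> ~ D 1 ->
       power_branch D (fun z => 1 - z) (- alpha - beta) xi2 ->
       quasi_polynomial_eigenfunction D (L1 alpha beta) (L2 alpha)
         (INR n - alpha - beta) xi2 (hr_poly n (- beta) (- alpha))).
Proof.
  intros alpha beta n Hw1 Hw2; split.
  - intros D [HD [_ Hne]]; split; [apply hr_poly_is_polynomial|].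
    destruct (hr_poly_ode n alpha beta Hw1) as [p1 [p2 [Hp1 [Hp2 Hode]]]].
    apply generalized_eigenfunction_intro with p1 p2; auto.
    + destruct (hr_poly_nonzero n alpha beta D Hw1 HD Hne) as [z [Hz Hz0]].
      exists z; split; [exact Hz|]; rewrite Cmult_1_l; exact Hz0.
    + intros z _.
      eapply is_C_derive_eq.
      * exact (is_C_derive_mult _ _ z _ _ (is_C_derive_const 1 z) (Hp1 z)).
      * cbv beta; ring.
    (* With [theta = n] the first-order coefficient becomes [1 - beta - n - (alpha + 2 - n) z] and
       the zeroth-order one [n (alpha + 1)], as in [hr_poly_ode]. *)
    + intros z _; rewrite <- (Hode z); ring.
  - intros D xi [HD [_ Hne]] HD1 Hb; split; [apply hr_poly_is_polynomial|].
    (* The exponent is recast as one embedded real number, as the modulus argument requires. *)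
    replace (- alpha - beta) with (RtoC (- alpha - beta)) in Hb
      by (rewrite RtoC_minus, RtoC_opp; reflexivity).
    destruct (hr_poly_ode n (- beta) (- alpha) Hw2) as [p1 [p2 [Hp1 [Hp2 Hode]]]].
    set (p := hr_poly n (- beta) (- alpha)) in *.
    assert (Hz1 : forall z, D z -> 1 - z <> 0).
    { intros z Hz; apply one_sub_neq_0; congruence. }
    set (r := alpha + beta).
    assert (Hr : - RtoC (- alpha - beta) = r)
      by (unfold r; rewrite RtoC_minus, RtoC_opp; ring).
    assert (Hxi : forall z, D z -> is_C_derive xi z (r * xi z / (1 - z))).
    { intros z Hz; rewrite <- Hr; now apply (power_branch_derive D). }
    assert (Hinv : forall z, D z ->
      is_C_derive (fun z => r * xi z / (1 - z)) z (r * (r + 1) * xi z / (1 - z) ^ 2)).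
    { intros z Hz; assert (Hz' := Hz1 z Hz).
      eapply is_C_derive_eq.
      - refine (is_C_derive_mult _ _ z _ _
                  (is_C_derive_mult _ _ z _ _ (is_C_derive_const r z) (Hxi z Hz)) _).
        exact (is_C_derive_comp Cinv _ z _ _ (is_C_derive_inv _ Hz')
                 (is_C_derive_one_sub z)).
      - cbv beta; field; exact Hz'. }
    apply generalized_eigenfunction_intro with
      (fun z => r * xi z / (1 - z) * p z + xi z * p1 z)
      (fun z => r * (r + 1) * xi z / (1 - z) ^ 2 * p z + r * xi z / (1 - z) * p1 z
                + (r * xi z / (1 - z) * p1 z + xi z * p2 z)); auto.
    + destruct (hr_poly_nonzero n (- beta) (- alpha) D Hw2 HD Hne) as [z [Hz Hz0]].
      exists z; split; [exact Hz|]; apply Cmult_neq_0; [|exact Hz0].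
      exact (power_branch_neq_0 D _ xi _ z Hb Hz).
    + intros z Hz; apply is_C_derive_mult; auto.
    + intros z Hz; apply is_C_derive_plus; [|now apply is_C_derive_mult; auto].
      apply (is_C_derive_mult (fun z => r * xi z / (1 - z)) p z); auto.
    + intros z Hz.
      assert (Hz' := Hz1 z Hz).
      (* The expression is [xi] times the hypergeometric operator applied to [p]. In the coefficient
         of [p], the two terms over [1 - z] add up to [r (1 - beta)] because [r = alpha + beta];
         with the part from [theta = n - r] this leaves [n (1 - beta)]. *)
      transitivity (xi z * 0); [|ring].
      rewrite <- (Hode z); rewrite !RtoC_opp; unfold r; field; exact Hz'.
Qed.
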